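(* Let $k$ be an algebraically closed field of characteristic zero, let $G$ be a finite group and let $\phi,\psi:G\to S_n$ be two permutation representations of $G$ with the same character, $\chi_\phi=\chi_\psi$. Then there is an invertible element $c\in k[S_n]$ such that $\phi(g)=c\,\psi(g)\,c^{-1}$ for every $g\in G$ and such that $F=\Delta(c)^{-1}(c\otimes c)$ is a $\psi(G)$-invariant element of $k[S_n]^{\otimes 2}$.
   Context: A permutation representation of $G$ is a group homomorphism $\phi:G\to S_n=\mathrm{Aut}(X)$ to the group of permutations of a finite set $X$ with $|X|=n$. Its character is $\chi_\phi(g)=|\{x\in X : \phi(g)(x)=x\}|$. $\Delta:k[S_n]\to k[S_n]\otimes k[S_n]$ is the algebra homomorphism with $\Delta(\sigma)=\sigma\otimes\sigma$ for $\sigma\in S_n$. An element $F\in k[S_n]^{\otimes 2}$ is $\psi(G)$-invariant if it commutes with $\psi(g)\otimes\psi(g)$ for all $g\in G$. *)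

(* Defs.v *)
From HB Require Import structures.
From mathcomp Require Import all_boot all_order all_fingroup all_algebra.
From mathcomp Require Import falgebra.

Set Implicit Arguments.
Unset Strict Implicit.
Unset Printing Implicit Defensive.

Import GroupScope GRing.Theory.
Local Open Scope ring_scope.

(* The function a stands for the formal sum of the a g . g. This is an alias
   because {ffun gT -> k} itself carries the pointwise product, whereas
   grpalg k gT carries the convolution product. *)
Definition grpalg (k : fieldType) (gT : finGroupType) : Type := {ffun gT -> k}.

Section GroupAlgebra.
Variables (k : fieldType) (gT : finGroupType).

HB.instance Definition _ :=
  Vector.copy (grpalg k gT) {ffun gT -> k^o}.

Implicit Types a b : grpalg k gT.

Definition gcoef a (g : gT) : k := (a : {ffun gT -> k}) g.

Definition gmul a b : grpalg k gT :=
  [ffun g => \sum_h gcoef a h * gcoef b (h^-1 * g)%g].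

Definition gelt (g : gT) : grpalg k gT := [ffun h => (h == g)%:R].

Lemma galgP a b : (forall g, gcoef a g = gcoef b g) -> a = b.
Proof. by move=> eq_ab; apply/ffunP. Qed.

Lemma gcoef_elt g h : gcoef (gelt g) h = (h == g)%:R.
Proof. by rewrite /gcoef ffunE. Qed.

Lemma gcoefD a b g : gcoef (a + b) g = gcoef a g + gcoef b g.
Proof. by rewrite /gcoef ffunE. Qed.

Lemma gcoef0 g : gcoef 0 g = 0.
Proof. by rewrite /gcoef ffunE. Qed.

Lemma gcoefZ (x : k) a g : gcoef (x *: a) g = x * gcoef a g.
Proof. by rewrite /gcoef ffunE. Qed.

Lemma gcoef_sum I r (P : pred I) (F : I -> grpalg k gT) g :
  gcoef (\sum_(i <- r | P i) F i) g = \sum_(i <- r | P i) gcoef (F i) g.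
Proof.
by apply: (big_morph (fun a => gcoef a g)) => [a b|]; rewrite (gcoefD, gcoef0).
Qed.

Lemma gcoef_mul a b g :
  gcoef (gmul a b) g = \sum_h gcoef a h * gcoef b (h^-1 * g)%g.
Proof. by rewrite /gcoef ffunE. Qed.

Fact gmulA : associative gmul.
Proof.
move=> a b c; apply: galgP => g; rewrite !gcoef_mul.
under eq_bigr do rewrite gcoef_mul mulr_sumr.
under [RHS]eq_bigr do rewrite gcoef_mul mulr_suml.
rewrite [RHS]exchange_big; apply: eq_bigr => h _ /=.
rewrite [RHS](reindex_inj (mulgI h)); apply: eq_bigr => i _ /=.
by rewrite mulrA mulKg invMg mulgA.
Qed.

Fact gmul1l : left_id (gelt 1%g) gmul.
Proof.
move=> a; apply: galgP => g; rewrite gcoef_mul (bigD1 1%g) //= big1 => [|h /negPf].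
  by rewrite gcoef_elt eqxx mul1r invg1 mul1g addr0.
by rewrite gcoef_elt => ->; rewrite mul0r.
Qed.

Fact gmul1r : right_id (gelt 1%g) gmul.
Proof.
move=> a; apply: galgP => g; rewrite gcoef_mul (bigD1 g) //= big1 => [|h neq_hg].
  by rewrite gcoef_elt mulVg eqxx mulr1 addr0.
by rewrite gcoef_elt -eq_mulVg1 (negPf neq_hg) mulr0.
Qed.

Fact gmulDl : left_distributive gmul +%R.
Proof.
move=> a b c; apply: galgP => g; rewrite gcoefD !gcoef_mul -big_split /=.
by apply: eq_bigr => h _; rewrite gcoefD mulrDl.
Qed.

Fact gmulDr : right_distributive gmul +%R.
Proof.
move=> a b c; apply: galgP => g; rewrite gcoefD !gcoef_mul -big_split /=.
by apply: eq_bigr => h _; rewrite gcoefD mulrDr.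
Qed.

Fact gone_neq0 : gelt 1%g != 0.
Proof.
apply/eqP => /(congr1 (fun a => gcoef a 1%g)) /eqP.
by rewrite gcoef_elt gcoef0 eqxx oner_eq0.
Qed.

HB.instance Definition _ := GRing.Zmodule_isNzRing.Build (grpalg k gT)
  gmulA gmul1l gmul1r gmulDl gmulDr gone_neq0.

Fact gscaleAl (x : k) a b : x *: (a * b) = x *: a * b.
Proof.
apply: galgP => g; rewrite gcoefZ !gcoef_mul mulr_sumr.
by apply: eq_bigr => h _; rewrite gcoefZ mulrA.
Qed.

HB.instance Definition _ :=
  GRing.Lmodule_isLalgebra.Build k (grpalg k gT) gscaleAl.

Fact gscaleAr (x : k) a b : x *: (a * b) = a * (x *: b).
Proof.
apply: galgP => g; rewrite gcoefZ !gcoef_mul mulr_sumr.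
by apply: eq_bigr => h _; rewrite gcoefZ mulrCA.
Qed.

HB.instance Definition _ :=
  GRing.Lalgebra_isAlgebra.Build k (grpalg k gT) gscaleAr.

HB.instance Definition _ := Algebra_isFalgebra.Build k (grpalg k gT).

Lemma gelt1 : gelt 1%g = 1.
Proof. by []. Qed.

Lemma geltM g h : gelt (g * h)%g = gelt g * gelt h.
Proof.
apply: galgP => i; rewrite gcoef_mul (bigD1 g) //= big1 => [|j /negPf].
  by rewrite !gcoef_elt eqxx mul1r addr0 (canF_eq (mulKVg g)).
by rewrite gcoef_elt => ->; rewrite mul0r.
Qed.

Lemma galg_sum a : a = \sum_g gcoef a g *: gelt g.
Proof.
apply: galgP => g; rewrite gcoef_sum (bigD1 g) //= big1 => [|h /negPf neq_hg].
  by rewrite gcoefZ gcoef_elt eqxx mulr1 addr0.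
by rewrite gcoefZ gcoef_elt eq_sym neq_hg mulr0.
Qed.

End GroupAlgebra.

Arguments gelt {k gT} g.

(* k[gT] (x) k[gT] is realized as k[gT * gT], the pure tensor of g and h being
   the basis element (g, h); see tens_universal and tensM. *)
Notation grpalg2 k gT := (grpalg k (gT * gT)%type).

Section TensorSquare.
Variables (k : fieldType) (gT : finGroupType).
Implicit Types a b : grpalg k gT.

Definition tens a b : grpalg2 k gT :=
  [ffun x : gT * gT => gcoef a x.1 * gcoef b x.2].

Lemma gcoef_tens a b x : gcoef (tens a b) x = gcoef a x.1 * gcoef b x.2.
Proof. by rewrite /gcoef ffunE. Qed.

Lemma tens_linearl b : linear (tens^~ b).
Proof.
move=> x a1 a2; apply: galgP => g.
by rewrite gcoefD gcoefZ !gcoef_tens gcoefD gcoefZ mulrDl mulrA.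
Qed.

Lemma tens_linearr a : linear (tens a).
Proof.
move=> x b1 b2; apply: galgP => g.
by rewrite gcoefD gcoefZ !gcoef_tens gcoefD gcoefZ mulrDr mulrCA.
Qed.

Lemma tens_elt g h : tens (gelt g) (gelt h) = gelt (g, h).
Proof.
by apply: galgP => -[x y]; rewrite gcoef_tens !gcoef_elt -natrM mulnb.
Qed.

Lemma tens1 : tens 1 1 = 1.
Proof. exact: tens_elt. Qed.

Lemma tensM a1 a2 b1 b2 : tens a1 b1 * tens a2 b2 = tens (a1 * a2) (b1 * b2).
Proof.
apply: galgP => -[x y]; rewrite gcoef_tens !gcoef_mul /= big_distrlr /=.
rewrite pair_bigA /=; apply: eq_bigr => -[g h] _ /=.
by rewrite !gcoef_tens mulrACA.
Qed.

Lemma tens_universal (V : lmodType k) (f : grpalg k gT -> grpalg k gT -> V) :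
    (forall b, linear (f^~ b)) -> (forall a, linear (f a)) ->
  exists2 u : {linear grpalg2 k gT -> V},
      (forall a b, u (tens a b) = f a b)
    & forall v : {linear grpalg2 k gT -> V},
        (forall a b, v (tens a b) = f a b) -> v =1 u.
Proof.
move=> fl fr.
pose u (t : grpalg2 k gT) := \sum_x gcoef t x *: f (gelt x.1) (gelt x.2).
have u_lin : linear u.
  move=> x s t; rewrite /u scaler_sumr -big_split /=; apply: eq_bigr => g _.
  by rewrite gcoefD gcoefZ scalerDl scalerA.
pose uL := GRing.isLinear.Build _ _ _ _ u u_lin.
pose U : {linear grpalg2 k gT -> V} := HB.pack u uL.
exists U => [a b | v vE t].
  pose Fl b := GRing.isLinear.Build _ _ _ _ (f^~ b) (fl b).
  pose FL b : {linear grpalg k gT -> V} := HB.pack (f^~ b) (Fl b).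
  pose Fr a := GRing.isLinear.Build _ _ _ _ (f a) (fr a).
  pose FR a : {linear grpalg k gT -> V} := HB.pack (f a) (Fr a).
  transitivity (\sum_g \sum_h gcoef (tens a b) (g, h) *: f (gelt g) (gelt h)).
    by rewrite pair_bigA; apply: eq_bigr => -[].
  rewrite {2}[a]galg_sum -[RHS]/(FL b _) linear_sum; apply: eq_bigr => g _.
  rewrite linearZ_LR /= {2}[b]galg_sum -[f _ _]/(FR _ _) linear_sum scaler_sumr.
  by apply: eq_bigr => h _; rewrite linearZ_LR /= gcoef_tens scalerA.
rewrite [t in LHS]galg_sum linear_sum /= /u; apply: eq_bigr => -[g h] _.
by rewrite linearZ_LR /= -tens_elt vE.
Qed.

Definition Delta a : grpalg2 k gT := \sum_g gcoef a g *: gelt (g, g).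

Fact Delta_is_linear : linear Delta.
Proof.
move=> x a b; rewrite /Delta scaler_sumr -big_split /=; apply: eq_bigr => g _.
by rewrite gcoefD gcoefZ scalerDl scalerA.
Qed.

HB.instance Definition _ := GRing.isLinear.Build k _ _ _ Delta Delta_is_linear.

Lemma Delta_elt g : Delta (gelt g) = tens (gelt g) (gelt g).
Proof.
rewrite /Delta (bigD1 g) //= big1 => [|h /negPf neq_hg].
  by rewrite gcoef_elt eqxx scale1r addr0 tens_elt.
by rewrite gcoef_elt neq_hg scale0r.
Qed.

Fact Delta_is_monoid_morphism : monoid_morphism Delta.
Proof.
split=> [|a b]; first by rewrite Delta_elt tens1.
rewrite (galg_sum a) (galg_sum b) mulr_suml !linear_sum mulr_suml.
apply: eq_bigr => g _; rewrite mulr_sumr !linear_sum mulr_sumr.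
apply: eq_bigr => h _.
rewrite -scalerAl -scalerAr !linearZ_LR /= -scalerAl -scalerAr.
by rewrite -geltM !Delta_elt tensM geltM.
Qed.

HB.instance Definition _ :=
  GRing.isMonoidMorphism.Build _ _ Delta Delta_is_monoid_morphism.

End TensorSquare.

(* The product of {perm X} is (s * t) x = t (s x), the opposite of functional
   composition; s |-> s^-1 identifies the two groups and preserves fixed
   points. *)
Section PermutationRepresentations.
Variables (gT : finGroupType) (G : {group gT}) (X : finType).

Definition perm_char (phi : {morphism G >-> {perm X}}) (g : gT) : nat :=
  #|[set x : X | phi g x == x]|.

Definition rep_invariant (k : fieldType) (psi : {morphism G >-> {perm X}})
    (F : grpalg2 k {perm X}) : Prop :=
  forall g, g \in G ->
    GRing.comm F (tens (gelt (psi g)) (gelt (psi g))).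

End PermutationRepresentations.

(* Main.v *)
Require Import Defs.
From HB Require Import structures.
From mathcomp Require Import all_boot all_order all_fingroup all_algebra.
From mathcomp Require Import falgebra.
From mathcomp Require Import mxrepresentation algC classfun character.

Set Implicit Arguments.
Unset Strict Implicit.
Unset Printing Implicit Defensive.

Import GRing.Theory Num.Theory.
Local Open Scope ring_scope.

(** Write S for the symmetric group of X and k[S] for its group algebra.

    The twist condition is formal: once c intertwines psi and phi, both Delta c
    and c (x) c conjugate psi(g) (x) psi(g) into phi(g) (x) phi(g), so their
    quotient commutes with psi(g) (x) psi(g).  Everything lies in finding a unit
    c of k[S] with phi(g) c = c psi(g).

    Equal characters force phi(g) and psi(g) to be conjugate in S, for each g
    separately: the characters at the powers of g count, for every n, the points
    that lie on a cycle of length dividing n, hence determine the cycle type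
    ([perm_conj_of_fix]).

    To pass from elementwise conjugacy to a single c, let G x S act on the set S
    by x.(g, s) = phi(g)^-1 x s, and likewise with psi.  A point x is fixed by
    (g, s) when s = x^-1 phi(g) x, so the number of fixed points depends only on
    s and the conjugacy class of phi(g) ([card_fix_lr_conj]).  The two
    permutation modules of G x S thus have the same character and are isomorphic
    ([act_mx_iso]).  A map k[S] -> k[S] that commutes with the right translations
    by S is left multiplication by some c, and commuting with G says exactly that
    c intertwines psi and phi ([unit_intertwiner]).

    Character theory gives this isomorphism over the algebraic numbers, as an
    invertible matrix B.  Equivariance of B only says that certain entries of B
    are equal, so it survives any substitution applied to the values of the
    entries.  The determinant is a polynomial in these values that does not
    vanish identically, so natural numbers can be substituted for them without
    killing it ([det_specialize_nat]); a nonzero integer determinant then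
    remains nonzero in any field of characteristic zero ([det_natr_pchar0]). *)

(** * Permutations with equally many fixed points in all powers *)

Section PermConj.
Local Open Scope nat_scope.
Variable X : finType.
Implicit Types (f g : X -> X) (s t : {perm X}).

Lemma eq_iter_mod_order f x i j : injective f ->
  (iter i f x == iter j f x) = (i == j %[mod fingraph.order f x]).
Proof.
move=> inj_f; pose d := fingraph.order f x.
have iterE m : iter m f x = iter (m %% d) f x.
  rewrite {1}(divn_eq m d) addnC iterD; congr (iter _ f _).
  by elim: (m %/ d) => // q IHq; rewrite mulSn iterD IHq iter_order.
apply/eqP/eqP => [|eq_ij]; last by rewrite iterE eq_ij -iterE.
rewrite iterE (iterE j) => /(congr1 (findex f x)).
by rewrite !findex_iter // ltn_mod fingraph.order_gt0.
Qed.

Lemma fix_iter_dvd f n x : injective f ->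
  (iter n f x == x) = (fingraph.order f x %| n).
Proof. by move=> /(eq_iter_mod_order x n 0); rewrite mod0n => ->. Qed.

(** The points fixed by the d-th iterate are those whose orbit length divides d;
    by induction on d, these counts determine the number of points on orbits of
    length exactly d. *)
Lemma card_order_set_eq f g : injective f -> injective g ->
    (forall n, #|[set x | iter n f x == x]| = #|[set x | iter n g x == x]|) ->
  forall d, #|order_set f d| = #|order_set g d|.
Proof.
move=> inj_f inj_g eq_fix; elim/ltn_ind => d IHd.
have [-> | d_gt0] := posnP d.
  by rewrite !eq_card0 // => x; rewrite !inE -leqn0 leqNgt fingraph.order_gt0.
have fixE (h : X -> X) : injective h ->
    #|[set x | iter d h x == x]| =
      (\sum_(e < d | e %| d) #|order_set h e| + #|order_set h d|)%N.
  move=> inj_h; transitivity (\sum_(e < d.+1 | e %| d) #|order_set h e|)%N.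
    rewrite -sum1_card
      (partition_big (fun x => inord (fingraph.order h x) : 'I_d.+1)
        (fun e : 'I_d.+1 => e %| d)) /=.
      apply: eq_bigr => e dv_e; rewrite -sum1_card; apply: eq_bigl => x.
      rewrite !inE fix_iter_dvd //; have [dv_x | ndv_x] := boolP (_ %| d).
        by rewrite -val_eqE /= inordK // ltnS dvdn_leq.
      by apply/esym/negP => /eqP xe; case/negP: ndv_x; rewrite xe.
    move=> x; rewrite !inE fix_iter_dvd // => dv_x.
    by rewrite inordK // ltnS dvdn_leq.
  by rewrite big_mkcond big_ord_recr /= dvdnn -big_mkcond.
apply/eqP; move/eqP: (eq_fix d); rewrite !fixE //.
rewrite (eq_bigr (fun e : 'I_d => #|order_set g e|)) ?eqn_add2l // => e _.
by rewrite IHd.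
Qed.

Lemma order_iter f i x : injective f ->
  fingraph.order f (iter i f x) = fingraph.order f x.
Proof.
move=> inj_f; apply: eq_card => y.
rewrite -!topredE /=.
by rewrite (same_connect (fconnect_sym inj_f) (fconnect_iter f i x)).
Qed.

Lemma card_froots_eq f g : injective f -> injective g ->
    (forall d, #|order_set f d| = #|order_set g d|) ->
  forall d, fcard f (order_set f d) = fcard g (order_set g d).
Proof.
move=> inj_f inj_g eq_card d; have [-> | d_gt0] := posnP d.
  by rewrite /n_comp_mem !eq_card0 // => x;
    rewrite !inE -[_ == 0]leqn0 leqNgt fingraph.order_gt0 andbF.
have cl (h : X -> X) : injective h -> fclosed h (order_set h d).
  by move=> inj_h x _ /eqP <-; rewrite !inE (order_iter 1 x inj_h).
apply/eqP; rewrite -(eqn_pmul2r d_gt0).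
by rewrite !fcard_order_set ?eq_card //; try exact: cl; apply/subsetP.
Qed.

(** Equal fixed-point counts for all powers give as many cycles of each length in
    s as in t.  The conjugating permutation matches the cycles through a
    length-preserving bijection h between their chosen roots, and sends the i-th
    iterate of a root r under s to the i-th iterate of h r under t. *)
Lemma perm_conj_of_fix s t :
    (forall n, #|[set x | (s ^+ n)%g x == x]| = #|[set x | (t ^+ n)%g x == x]|) ->
  exists u : {perm X}, (s ^ u)%g = t.
Proof.
move=> eq_fix; have [inj_s inj_t] : injective s /\ injective t.
  by split; apply: perm_inj.
have eq_roots : forall d, fcard s (order_set s d) = fcard t (order_set t d).
  apply: card_froots_eq => //; apply: card_order_set_eq => // n.
  have setE (w : {perm X}) :
      [set x | iter n w x == x] = [set x | (w ^+ n)%g x == x].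
    by apply/setP => x; rewrite !inE permX.
  by rewrite !setE.
have [x0 _ | X0] := pickP (@predT X); last first.
  by exists 1%g; apply/permP => x; have := X0 x.
(* The i-th listed root of an s-cycle of length d goes to the i-th listed root
   of a t-cycle of length d; x0 is only a default for nth. *)
pose rts f d := enum [predI froots f & order_set f d].
pose h r := let d := fingraph.order s r in nth x0 (rts t d) (index r (rts s d)).
pose root_s := froot s.
have rt_mem x : root_s x \in rts s (fingraph.order s x).
  rewrite mem_enum !inE (roots_root (fconnect_sym inj_s)) /=.
  have /iter_findex <- : fconnect s x (root_s x) by exact: connect_root.
  by rewrite order_iter.
have ord_rt x : fingraph.order s (root_s x) = fingraph.order s x.
  by have:= rt_mem x; rewrite mem_enum !inE => /andP[_ /eqP].
have sz d : size (rts s d) = size (rts t d).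
  by rewrite /rts -!cardE; apply: eq_roots.
have h_mem x : h (root_s x) \in rts t (fingraph.order s x).
  by rewrite /h ord_rt mem_nth // -sz index_mem.
have h_root x : froots t (h (root_s x)).
  by have:= h_mem x; rewrite mem_enum !inE => /andP[].
have h_ord x : fingraph.order t (h (root_s x)) = fingraph.order s x.
  by have:= h_mem x; rewrite mem_enum !inE => /andP[_ /eqP].
have h_inj x y : h (root_s x) = h (root_s y) -> root_s x = root_s y.
  move=> eq_h; have eq_o: fingraph.order s x = fingraph.order s y.
    by rewrite -!h_ord eq_h.
  have mx : root_s x \in rts s (fingraph.order s y) by rewrite -eq_o.
  move/eqP: eq_h; rewrite /h !ord_rt eq_o.
  rewrite nth_uniq -?sz ?index_mem ?enum_uniq // => /eqP eq_i.
  by rewrite -(nth_index x0 mx) eq_i nth_index.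
pose idx x := findex s (root_s x) x.
have rt_conn x : fconnect s (root_s x) x.
  by rewrite (fconnect_sym inj_s); exact: connect_root.
have idxK x : iter (idx x) s (root_s x) = x by apply: iter_findex.
pose u x := iter (idx x) t (h (root_s x)).
(* The exponents findex r (s x) and (findex r x).+1 may differ, but they agree
   modulo the common length of the two matched cycles. *)
have u_comm x : u (s x) = t (u x).
  have rt_sx : root_s (s x) = root_s x.
    by apply/eqP; rewrite eq_sym (root_connect (fconnect_sym inj_s)) fconnect1.
  apply/eqP; rewrite /u rt_sx -[t (iter _ _ _)]/(iter (idx x).+1 t _).
  rewrite eq_iter_mod_order // h_ord -(ord_rt x) -eq_iter_mod_order //=.
  by rewrite idxK -{1}rt_sx idxK.
have rt_u x : froot t (u x) = h (root_s x).
  rewrite -[RHS](eqP (h_root x)); apply/eqP.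
  by rewrite eq_sym (root_connect (fconnect_sym inj_t)) fconnect_iter.
have u_inj : injective u.
  move=> x y eq_u; have eq_r: root_s x = root_s y.
    by apply: h_inj; rewrite -!rt_u eq_u.
  move/eqP: eq_u; rewrite /u eq_r eq_iter_mod_order // h_ord -ord_rt.
  by rewrite -eq_iter_mod_order // idxK -eq_r idxK => /eqP.
exists (perm u_inj); rewrite conjgE -(mulKg (perm u_inj) t); congr (_ * _)%g.
by apply/permP => x; rewrite !permM !permE u_comm.
Qed.
End PermConj.

(** * Permutation modules over the algebraic numbers *)

Section PermutationModules.
Variables (aT : finGroupType) (H : {group aT}) (T : finType).
Local Notation n := #|T|.

Definition act_mx (R : comUnitRingType) (to : action H T) (a : aT) : 'M[R]_n :=
  \matrix_(i, j) (to (enum_val i) a == enum_val j)%:R.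

Lemma act_mx_mulE (R : comUnitRingType) (to : action H T) a (B : 'M[R]_n) x y :
  (act_mx R to a *m B) (enum_rank x) (enum_rank y)
    = B (enum_rank (to x a)) (enum_rank y).
Proof.
rewrite mxE (bigD1 (enum_rank (to x a))) //= mxE !enum_rankK eqxx mul1r.
rewrite big1 ?addr0 // => i; rewrite mxE enum_rankK => ne_i.
by rewrite eq_sym (can2_eq (@enum_valK T) (@enum_rankK T)) (negPf ne_i) mul0r.
Qed.

Lemma mul_act_mxE (R : comUnitRingType) (to : action H T) a (B : 'M[R]_n) x y :
  (B *m act_mx R to a) (enum_rank x) (enum_rank (to y a))
    = B (enum_rank x) (enum_rank y).
Proof.
rewrite mxE (bigD1 (enum_rank y)) //= mxE !enum_rankK eqxx mulr1.
rewrite big1 ?addr0 // => i ne_i; rewrite mxE enum_rankK.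
by rewrite (inj_eq (act_inj to a)) (can2_eq (@enum_valK T) (@enum_rankK T))
  (negPf ne_i) mulr0.
Qed.

Lemma act_mx_repr (R : comUnitRingType) (to : action H T) :
  mx_repr H (act_mx R to).
Proof.
split=> [|a b aH bH]; apply/matrixP=> i j.
  rewrite !mxE -[act to _ _](_ : enum_val i = _) ?(inj_eq enum_val_inj) //.
  exact/esym/act1.
rewrite -(enum_valK i) -(enum_valK j) act_mx_mulE !mxE !enum_rankK.
by rewrite actMin.
Qed.

Lemma act_mx_trace (R : comUnitRingType) (to : action H T) a :
  \tr (act_mx R to a) = #|'Fix_to[a]%g|%:R.
Proof.
rewrite -sum1_card natr_sum big_mkcond /=.
rewrite (reindex _ (onW_bij _ (enum_val_bij T))) /=.
by apply: eq_bigr => i _; rewrite mxE (sameP afix1P eqP); case: eqP.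
Qed.

(** The trace of a permutation matrix counts fixed points, so the two modules
    have the same character, hence are isomorphic.  In coordinates, a map between
    permutation modules is equivariant when its matrix is constant on the orbits
    of the diagonal action on pairs. *)
Lemma act_mx_iso (to1 to2 : action H T) :
    (forall a, a \in H -> #|'Fix_to1[a]%g| = #|'Fix_to2[a]%g|) ->
  exists2 B : 'M[algC]_n, \det B != 0
    & forall a x y, a \in H ->
      B (enum_rank (to1 x a)) (enum_rank (to2 y a))
        = B (enum_rank x) (enum_rank y).
Proof.
move=> eq_fix.
pose r to := MxRepresentation (act_mx_repr algC to).
have /cfRepr_inj sim : cfRepr (r to1) = cfRepr (r to2).
  by apply/cfun_inP=> a aH; rewrite !cfunE aH /= !act_mx_trace eq_fix.
case: sim => B _ B_free B_comm; exists B => [|a x y aH].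
  by rewrite -unitfE -unitmxE -row_free_unit.
rewrite -(act_mx_mulE to1) -(mul_act_mxE to2 a B x y).
by have -> : act_mx _ to1 a *m B = B *m act_mx _ to2 a := B_comm a aH.
Qed.
End PermutationModules.

(** * Descent of an invertible matrix to the natural numbers *)

Lemma poly_nat_nonroot (F : numDomainType) (p : {poly F}) :
  p != 0 -> exists m : nat, p.[m%:R] != 0.
Proof.
move=> nz_p; pose rs := [seq m%:R : F | m <- iota 0 (size p)].
have /allPn[_ /mapP[m _ ->] nr] : ~~ all (root p) rs.
  apply/negP => /(max_poly_roots nz_p).
  rewrite map_inj_uniq ?iota_uniq => [/(_ isT)|].
    by rewrite size_map size_iota ltnn.
  exact: mulrIn (oner_neq0 F).
by exists m.
Qed.

(** The matrix obtained from B by f has at least the coincidences between entries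
    that B has.  The values are replaced one at a time: as a function of a single
    value, the others being held fixed, the determinant is a polynomial that is
    nonzero at the current value, so it is nonzero at some natural number. *)
Lemma det_specialize_nat (F : numDomainType) n (B : 'M[F]_n) :
  \det B != 0 ->
  exists f : F -> nat, \det (map_mx (fun x => (f x)%:R : F) B) != 0.
Proof.
move=> nz_B; pose vals := [seq B ij.1 ij.2 | ij : 'I_n * 'I_n].
suff [v [f vE] nz_v] : exists2 v : F -> F,
    exists f : F -> nat, {in vals, forall x, v x = (f x)%:R}
    & \det (map_mx v B) != 0.
  exists f; congr (\det _ != 0): nz_v; apply/matrixP => i j; rewrite !mxE vE //.
  by apply/mapP; exists (i, j); rewrite ?mem_enum.
elim: vals => [|a s [v [f vE] nz_v]].
  by exists id; [exists (fun=> 0%N) | rewrite map_mx_id].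
(* All entries equal to a become the indeterminate together. *)
pose P : 'M[{poly F}]_n := map_mx (fun x => if x == a then 'X else (v x)%:P) B.
have detP t : (\det P).[t] =
    \det (map_mx (fun x => if x == a then t else v x) B).
  rewrite -horner_evalE -det_map_mx; congr (\det _); apply/matrixP => i j.
  by rewrite !mxE /= horner_evalE; case: ifP => _; rewrite ?hornerX ?hornerC.
have [|m nz_m] := @poly_nat_nonroot _ (\det P).
  apply: contraNneq nz_v => P0; rewrite -(horner0 (v a)) -P0 detP.
  apply/eqP; congr (\det _).
  by apply/matrixP => i j; rewrite !mxE; case: eqP => // ->.
exists (fun x => if x == a then m%:R else v x); last by rewrite -detP.
exists (fun x => if x == a then m else f x) => x; rewrite inE.
by case: eqP => //= _; apply: vE.
Qed.

Lemma det_natr_pchar0 (F : numDomainType) (k : fieldType) n (A : 'M[nat]_n) :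
  [pchar k] =i pred0 ->
  \det (map_mx (fun m => m%:R : F) A) != 0 ->
  \det (map_mx (fun m => m%:R : k) A) != 0.
Proof.
move=> k0; have detE (R : comNzRingType) : \det (map_mx (fun m => m%:R : R) A)
    = (\det (map_mx (fun m => m%:R : int) A))%:~R.
  rewrite -det_map_mx; congr (\det _); apply/matrixP => i j.
  by rewrite !mxE /= rmorph_nat.
rewrite (detE F) (detE k); apply: contraNneq; case: (\det _) => m /eqP.
  by rewrite -pmulrn (pcharf0P _).1 // => /eqP ->.
by rewrite NegzE rmorphN oppr_eq0 /= -pmulrn (pcharf0P _).1.
Qed.

(** * Units of a group algebra *)

Section GroupDeterminant.
Variables (k : fieldType) (sT : finGroupType) (c : grpalg k sT).

(** The matrix of the left multiplication by c in the basis of group elements,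
    whose determinant is the group determinant evaluated at c. *)
Definition lmul_mx : 'M[k]_#|sT| :=
  \matrix_(i, j) gcoef c (enum_val i * (enum_val j)^-1)%g.

Lemma mul_lmul_mx (a : grpalg k sT) :
  lmul_mx *m (\col_j gcoef a (enum_val j)) = \col_i gcoef (c * a) (enum_val i).
Proof.
apply/matrixP=> i j; rewrite !mxE gcoef_mul.
rewrite [RHS](reindex (fun l : 'I_#|sT| => enum_val i * (enum_val l)^-1)%g) /=.
  by apply: eq_bigr => l _; rewrite !mxE invMg invgK mulgKV.
apply: onW_bij; exists (fun x => enum_rank (x^-1 * enum_val i)%g) => x.
  by rewrite invMg invgK mulgKV enum_valK.
by rewrite enum_rankK invMg invgK mulKVg.
Qed.

(** Solving c d = 1 gives a right inverse d; it is a left inverse too because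
    c (d c) = c and left multiplication by c is injective. *)
Lemma lmul_mx_unit : \det lmul_mx != 0 -> c \is a GRing.unit.
Proof.
rewrite -unitfE -unitmxE => uM.
have mul_inj a b : c * a = c * b -> a = b.
  move=> eq_ab; apply: galgP => g.
  have: lmul_mx *m (\col_j gcoef a (enum_val j)) =
      lmul_mx *m (\col_j gcoef b (enum_val j)).
    by rewrite !mul_lmul_mx eq_ab.
  move/(can_inj (mulKmx uM))/matrixP/(_ (enum_rank g) 0).
  by rewrite !mxE enum_rankK.
pose y := invmx lmul_mx *m \col_j gcoef (1 : grpalg k sT) (enum_val j).
pose d : grpalg k sT := [ffun g => y (enum_rank g) 0].
have cd1 : c * d = 1.
  apply: galgP => g.
  have dE : \col_j gcoef d (enum_val j) = y.
    by apply/matrixP => i j; rewrite !mxE /gcoef ffunE enum_valK ord1 mxE.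
  have := mul_lmul_mx d; rewrite dE mulKVmx // => /matrixP/(_ (enum_rank g) 0).
  by rewrite !mxE enum_rankK.
apply/GRing.unitrP; exists d; split=> //; apply: mul_inj.
by rewrite mulrA cd1 mul1r mulr1.
Qed.
End GroupDeterminant.

(** * The intertwining unit *)

Lemma gcoef_gelt_mul (k : fieldType) (sT : finGroupType) (a : grpalg k sT) g x :
  gcoef (gelt g * a) x = gcoef a (g^-1 * x)%g.
Proof.
rewrite gcoef_mul (bigD1 g) //= gcoef_elt eqxx mul1r big1 ?addr0 // => h.
by rewrite gcoef_elt => /negPf->; rewrite mul0r.
Qed.

Lemma gcoef_mul_gelt (k : fieldType) (sT : finGroupType) (a : grpalg k sT) g x :
  gcoef (a * gelt g) x = gcoef a (x * g^-1)%g.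
Proof.
rewrite gcoef_mul (bigD1 (x * g^-1)%g) //= gcoef_elt invMg invgK mulgKV eqxx.
rewrite mulr1 big1 ?addr0 // => h.
rewrite gcoef_elt (can2_eq (mulKVg h) (mulKg h)) => ne_h.
case: eqP => [xE | _]; last by rewrite mulr0.
by rewrite xE mulgK eqxx in ne_h.
Qed.

Section LRAction.
Variables (gT sT : finGroupType) (G : {group gT}) (f : {morphism G >-> sT}).

(** The inverse makes this a right action.  It packages the left multiplications
    by f and the right multiplications by sT into an action of a single group. *)
Definition lr_act (x : sT) (gs : gT * sT) : sT := ((f gs.1)^-1 * x * gs.2)%g.

Lemma lr_act_is_action : is_action (setX G [set: sT]) lr_act.
Proof.
split=> [[g s] x y /mulIg/mulgI // | x [g s] [h t]].
rewrite !inE !andbT /= => gG hG.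
by rewrite /lr_act /= morphM // invMg !mulgA.
Qed.

Canonical lr_action := Action lr_act_is_action.
End LRAction.

(** Left translation by u carries the fixed points of one action to those of the
    other. *)
Lemma card_fix_lr_conj (gT sT : finGroupType) (G : {group gT})
    (f1 f2 : {morphism G >-> sT}) (gs : gT * sT) (u : sT) :
  (f1 gs.1 ^ u)%g = f2 gs.1 ->
  #|afix (lr_action f1) [set gs]| = #|afix (lr_action f2) [set gs]|.
Proof.
move=> f12; rewrite -(card_preimset _ (mulgI u)); apply: eq_card => x.
rewrite inE; apply/afix1P/afix1P;
  rewrite /= /lr_act -f12 conjgE !invMg invgK => fx.
  by rewrite -[RHS](mulKg u) -[in RHS]fx !mulgA.
by rewrite -[in RHS]fx !mulgA mulgV mul1g.
Qed.

(** Elementwise conjugate homomorphisms into sT become simultaneously conjugate by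
    a unit of k[sT].  The equivariant matrix b satisfies b (x s) (y s) = b x y,
    so b x y = b (x y^-1) 1: it is the matrix of the left multiplication by the
    element c with coefficients b x 1. *)
Lemma unit_intertwiner (k : fieldType) (gT sT : finGroupType) (G : {group gT})
    (f1 f2 : {morphism G >-> sT}) :
  [pchar k] =i pred0 ->
  (forall g, g \in G -> exists u, (f1 g ^ u)%g = f2 g) ->
  exists2 c : grpalg k sT, c \is a GRing.unit
    & forall g, g \in G -> gelt (f1 g) * c = c * gelt (f2 g).
Proof.
move=> k0 conj12.
have [[g s] /setXP[gG _] | B nzB invB] :=
  act_mx_iso (to1 := lr_action f1) (to2 := lr_action f2).
  by have [u uE] := conj12 g gG; apply: (card_fix_lr_conj (gs := (g, s)) uE).
have [v nz_v] := det_specialize_nat nzB.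
pose b x y := v (B (enum_rank x) (enum_rank y)).
have b_inv g s x y : g \in G ->
    b ((f1 g)^-1 * x * s)%g ((f2 g)^-1 * y * s)%g = b x y.
  by move=> gG; congr v; apply: (invB (g, s)); rewrite !inE gG.
have b_r s x y : b (x * s)%g (y * s)%g = b x y.
  by have := b_inv 1%g s x y (group1 G); rewrite !morph1 invg1 !mul1g.
pose c : grpalg k sT := [ffun x => (b x 1%g)%:R].
exists c => [|g gG].
  apply: lmul_mx_unit.
  have -> : lmul_mx c = map_mx (fun m => m%:R) (map_mx v B).
    apply/matrixP => i j; rewrite !mxE /gcoef ffunE -(b_r (enum_val j)).
    by rewrite mulgKV mul1g /b !enum_valK.
  apply: (det_natr_pchar0 k0 (F := algC)); rewrite -map_mx_comp.
  exact: nz_v.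
apply: galgP => x; rewrite gcoef_gelt_mul gcoef_mul_gelt /gcoef !ffunE.
rewrite -(b_r (f2 g) (x * _)%g) mulgKV mul1g.
by rewrite -(b_inv g 1%g x (f2 g) gG) mulVg !mulg1.
Qed.

Theorem proposition6 (k : closedFieldType) (hk : [pchar k] =i pred0)
    (gT : finGroupType) (G : {group gT}) (X : finType)
    (phi psi : {morphism G >-> {perm X}})
    (hchar : forall g, g \in G -> perm_char phi g = perm_char psi g) :
  exists c : grpalg k {perm X},
    [/\ c \is a GRing.unit,
        forall g, g \in G -> gelt (phi g) = c * gelt (psi g) * c^-1
      & rep_invariant psi ((Delta c)^-1 * tens c c)].
Proof.
have [g gG | c uc comm_c] := unit_intertwiner (f1 := phi) (f2 := psi) hk.
  apply: perm_conj_of_fix => n.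
  by rewrite -!morphX //; apply: hchar; rewrite groupX.
exists c; split=> // g gG; first by rewrite -comm_c // mulrK.
have uD : Delta c \is a GRing.unit by apply: rmorph_unit.
have DE : (Delta c)^-1 * Delta (gelt (phi g)) =
    Delta (gelt (psi g)) * (Delta c)^-1.
  apply: (mulrI uD).
  by rewrite mulVKr // mulrA -rmorphM -comm_c // rmorphM mulrK.
rewrite /GRing.comm -mulrA tensM -comm_c // -tensM -!Delta_elt mulrA DE.
by rewrite mulrA.
Qed.
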